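(* Let $p$ be a prime and let $\mathcal{F}$ be a saturated fusion system over the finite $p$-group $S$. If the map $H^2(\mathcal{F}/E^p_{\mathcal{F}}(S);\mathbb{F}_p)\to H^2(\mathcal{F};\mathbb{F}_p)$ induced by the quotient homomorphism $S\to S/E^p_{\mathcal{F}}(S)$ is a monomorphism, then $S/O^p_{\mathcal{F}}(S)$ is elementary abelian.
   Context: Fusion systems over finite $p$-groups are in the sense of Puig and Broto–Levi–Oliver: objects are the subgroups of $S$, morphisms are certain injective homomorphisms including those induced by conjugation in $S$, subject to the saturation axioms. $H^*(\mathcal{F};\mathbb{F}_p)=\{z\in H^*(S;\mathbb{F}_p)\mid \operatorname{res}(z)=\varphi^*(z)\text{ for each }P\le S,\ \varphi\in\operatorname{Hom}_{\mathcal{F}}(P,S)\}$, where $\operatorname{res}$ is restriction to $H^*(P;\mathbb{F}_p)$. The hyperfocal subgroup is $O^p_{\mathcal{F}}(S)=\langle [P,O^p(\operatorname{Aut}_{\mathcal{F}}(P))]\mid P\le S\rangle$, where $O^p(\operatorname{Aut}_{\mathcal{F}}(P))$ is the smallest normal subgroup of $p$-power index in $\operatorname{Aut}_{\mathcal{F}}(P)$ and $[P,A]=\langle x^{-1}\alpha(x)\mid x\in P,\alpha\in A\rangle$. The elementary focal subgroup is $E^p_{\mathcal{F}}(S)=\Phi(S)O^p_{\mathcal{F}}(S)$, where $\Phi(S)$ is the Frattini subgroup of $S$; it is strongly $\mathcal{F}$-closed. For a strongly $\mathcal{F}$-closed subgroup $T\le S$ (i.e. $\varphi(P)\le T$ for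 all $P\le T$, $\varphi\in\operatorname{Hom}_{\mathcal{F}}(P,S)$), the quotient fusion system $\mathcal{F}/T$ over $S/T$ has as morphisms $P/T\to Q/T$ (for $T\le P,Q\le S$) the homomorphisms induced by those $\psi\in\operatorname{Hom}_{\mathcal{F}}(P,Q)$. The inflation map $H^*(S/T;\mathbb{F}_p)\to H^*(S;\mathbb{F}_p)$ restricts to a map $H^*(\mathcal{F}/T;\mathbb{F}_p)\to H^*(\mathcal{F};\mathbb{F}_p)$. *)

(* Defs.v *)
From HB Require Import structures.
From mathcomp Require Import all_boot all_order all_fingroup all_algebra.
From mathcomp Require Import all_solvable.

Set Implicit Arguments.
Unset Strict Implicit.
Unset Printing Implicit Defensive.

Import GRing.Theory.
Local Open Scope group_scope.

(* H^n(G; 'F_p) is computed with the inhomogeneous bar resolution.  The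
   cohomology of a subgroup P : {group gT} is that of the finGroupType
   [subg P]. *)

Definition cochain (p n : nat) (G : finGroupType) : Type :=
  {ffun n.-tuple G -> 'F_p}.
HB.instance Definition _ p n G := Finite.on (cochain p n G).
HB.instance Definition _ p n G := GRing.Zmodule.on (cochain p n G).

(* Face 0 drops g_0, face i multiplies g_(i-1) by g_i for 0 < i <= n, and
   face n.+1 drops g_n. *)
Definition face (G : finGroupType) (n : nat) (i : 'I_n.+2)
    (g : n.+1.-tuple G) : n.-tuple G :=
  [tuple if (j.+1 < i)%N then tnth g (widen_ord (leqnSn n) j)
         else if (j.+1 == i)%N
           then tnth g (widen_ord (leqnSn n) j) * tnth g (lift ord0 j)
         else tnth g (lift ord0 j) | j < n].

Definition differential (p n : nat) (G : finGroupType) (c : cochain p n G) :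
    cochain p n.+1 G :=
  [ffun g => \sum_(i < n.+2) (-1) ^+ i * c (face i g)]%R.

Lemma differential_is_zmod_morphism p n G :
  zmod_morphism (@differential p n G).
Proof.
move=> c d; apply/ffunP=> g; rewrite !ffunE -sumrB.
by apply: eq_bigr => i _; rewrite !ffunE mulrBr.
Qed.
HB.instance Definition _ p n G :=
  GRing.isZmodMorphism.Build (cochain p n G) (cochain p n.+1 G)
    (@differential p n G) (@differential_is_zmod_morphism p n G).

Definition cocycle_pred (p n : nat) (G : finGroupType) : {pred cochain p n G} :=
  fun c => differential c == 0%R.

Lemma cocycle_zmod_closed p n G : zmod_closed (@cocycle_pred p n G).
Proof.
split=> [|c d]; rewrite !unfold_in ?raddf0 // => /eqP dc /eqP dd.
by rewrite raddfB /= dc dd subrr.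
Qed.
HB.instance Definition _ p n G :=
  GRing.isZmodClosed.Build (cochain p n G) (@cocycle_pred p n G)
    (@cocycle_zmod_closed p n G).

Record cocycle (p n : nat) (G : finGroupType) := Cocycle {
  cocycle_val :> cochain p n G;
  cocycleP : cocycle_val \in @cocycle_pred p n G
}.
HB.instance Definition _ p n G := [isSub for @cocycle_val p n G].
HB.instance Definition _ p n G := [Finite of cocycle p n G by <:].
HB.instance Definition _ p n G := [SubChoice_isSubZmodule of cocycle p n G by <:].

Definition coboundary_pred (p n : nat) (G : finGroupType) :
    {pred cocycle p n G} :=
  fun z => match n return cochain p n G -> bool with
           | 0 => fun c => c == 0%R
           | m.+1 => fun c => [exists b : cochain p m G, c == differential b]
           end z.

Lemma coboundary_zmod_closed p n G : zmod_closed (@coboundary_pred p n G).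
Proof.
case: n => [|n]; split=> [|c d]; rewrite !unfold_in //=.
- by move=> /eqP-> /eqP->; rewrite subrr.
- by apply/existsP; exists 0%R; rewrite raddf0.
move=> /existsP[b /eqP eb] /existsP[b' /eqP eb']; apply/existsP.
by exists (b - b')%R; rewrite raddfB /= -eb -eb'.
Qed.
HB.instance Definition _ p n G :=
  GRing.isZmodClosed.Build (cocycle p n G) (@coboundary_pred p n G)
    (@coboundary_zmod_closed p n G).

Definition cohomology (p n : nat) (G : finGroupType) : Type :=
  Quotient.quot (@coboundary_pred p n G).
HB.instance Definition _ p n G := GRing.Zmodule.on (cohomology p n G).
Arguments cohomology (p n)%_N G%_type.

Definition cohomology_class (p n : nat) (G : finGroupType)
    (z : cocycle p n G) : cohomology p n G :=
  (\pi_(Quotient.quot (@coboundary_pred p n G)) z)%qT.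

Definition cochain_pullback (p n : nat) (G H : finGroupType) (f : G -> H)
    (c : cochain p n H) : cochain p n G :=
  [ffun g => c (map_tuple f g)].

(* For a homomorphism f the default value 0 of insubd and the choice of a
   representative play no role: cocycle_pullbackE, cohomology_pullbackE. *)
Definition cocycle_pullback (p n : nat) (G H : finGroupType) (f : G -> H)
    (z : cocycle p n H) : cocycle p n G :=
  insubd (0%R : cocycle p n G) (cochain_pullback f z).

Definition cohomology_pullback (p n : nat) (G H : finGroupType) (f : G -> H)
    (x : cohomology p n H) : cohomology p n G :=
  cohomology_class (cocycle_pullback f (generic_quotient.repr x)).

Section PullbackTheory.
Variables (p : nat) (G H : finGroupType) (f : G -> H).
Hypothesis fM : {morph f : x y / x * y}.

Lemma face_map n (i : 'I_n.+2) (g : n.+1.-tuple G) :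
  face i (map_tuple f g) = map_tuple f (face i g).
Proof.
apply: eq_from_tnth => j; rewrite tnth_mktuple [RHS]tnth_map tnth_mktuple !tnth_map.
by case: ifP => // _; case: ifP => // _; rewrite fM.
Qed.

Lemma differential_pullback n (c : cochain p n H) :
  differential (cochain_pullback f c) = cochain_pullback f (differential c).
Proof.
apply/ffunP=> g; rewrite !ffunE; apply: eq_bigr => i _.
by rewrite ffunE face_map.
Qed.

Lemma cocycle_pullbackE n (z : cocycle p n H) :
  cocycle_pullback f z = cochain_pullback f z :> cochain p n G.
Proof.
apply: insubdK; have := cocycleP z; rewrite !unfold_in differential_pullback.
by move=> /eqP->; apply/eqP/ffunP=> g; rewrite !ffunE.
Qed.

Lemma cochain_pullbackB n (c d : cochain p n H) :
  cochain_pullback f (c - d)%R = (cochain_pullback f c - cochain_pullback f d)%R.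
Proof. by apply/ffunP=> g; rewrite !ffunE. Qed.

Lemma cocycle_pullbackB n (y z : cocycle p n H) :
  cocycle_pullback f (y - z)%R = (cocycle_pullback f y - cocycle_pullback f z)%R.
Proof.
by apply: val_inj; rewrite /= !cocycle_pullbackE /= cochain_pullbackB.
Qed.

Lemma coboundary_pullback n (z : cocycle p n H) :
  z \in @coboundary_pred p n H ->
  cocycle_pullback f z \in @coboundary_pred p n G.
Proof.
case: n z => [|n] z; rewrite !unfold_in cocycle_pullbackE.
  by move=> /eqP->; apply/eqP/ffunP=> g; rewrite !ffunE.
move=> /existsP[b /eqP->]; apply/existsP; exists (cochain_pullback f b).
by rewrite differential_pullback.
Qed.

Lemma cohomology_pullbackE n (z : cocycle p n H) :
  cohomology_pullback f (cohomology_class z)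
    = cohomology_class (cocycle_pullback f z).
Proof.
apply/eqP; rewrite -Quotient.idealrBE -cocycle_pullbackB.
by apply: coboundary_pullback; rewrite Quotient.idealrBE; apply/eqP; rewrite reprK.
Qed.

Lemma cohomology_pullbackB n (x y : cohomology p n H) :
  cohomology_pullback f (x - y)%R
    = (cohomology_pullback f x - cohomology_pullback f y)%R.
Proof.
suff E (z t : cocycle p n H) : cohomology_pullback f (cohomology_class z - cohomology_class t)%R
    = (cohomology_pullback f (cohomology_class z)
       - cohomology_pullback f (cohomology_class t))%R.
  by have := E (generic_quotient.repr x) (generic_quotient.repr y); rewrite /cohomology_class !reprK.
have cB (K : finGroupType) (a b : cocycle p n K) :
    (cohomology_class a - cohomology_class b)%R = cohomology_class (a - b)%R.
  by rewrite /cohomology_class raddfB.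
by rewrite cB !cohomology_pullbackE cocycle_pullbackB cB.
Qed.

End PullbackTheory.

(* A morphism P -> Q is represented by a function on the ambient group,
   considered up to its values outside P. *)
Definition hom_family (gT : finGroupType) : Type :=
  {group gT} -> {group gT} -> pred (gT -> gT).

Definition fusion_iso (gT : finGroupType) (F : hom_family gT)
    (P Q : {group gT}) (f : gT -> gT) : Prop :=
  F P Q f /\
  exists g, [/\ F Q P g, {in P, cancel f g} & {in Q, cancel g f}].

Record is_fusion_system (gT : finGroupType) (S : {group gT})
    (F : hom_family gT) : Prop := IsFusionSystem {
  fusion_obj : forall (P Q : {group gT}) f,
    F P Q f -> P \subset S /\ Q \subset S;
  fusion_ext : forall (P Q : {group gT}) f g,
    {in P, f =1 g} -> F P Q f = F P Q g;
  fusion_inj : forall (P Q : {group gT}) f, F P Q f ->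
    [/\ {in P &, {morph f : x y / x * y}}, {in P &, injective f}
      & f @: P \subset Q];
  fusion_conj : forall (P Q : {group gT}) s,
    P \subset S -> Q \subset S -> s \in S -> P :^ s \subset Q ->
    F P Q (conjg^~ s);
  fusion_comp : forall (P Q R : {group gT}) f g,
    F P Q f -> F Q R g -> F P R (g \o f);
  fusion_fact : forall (P Q : {group gT}) f, F P Q f ->
    exists2 R : {group gT}, R \subset Q & fusion_iso F P R f
}.

Definition fusion_conjugate (gT : finGroupType) (F : hom_family gT)
    (P Q : {group gT}) : Prop :=
  exists f, fusion_iso F P Q f.

Definition fully_centralized (gT : finGroupType) (S : {group gT})
    (F : hom_family gT) (P : {group gT}) : Prop :=
  P \subset S /\
  forall Q : {group gT}, fusion_conjugate F P Q -> (#|'C_S(Q)| <= #|'C_S(P)|)%N.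

Definition fully_normalized (gT : finGroupType) (S : {group gT})
    (F : hom_family gT) (P : {group gT}) : Prop :=
  P \subset S /\
  forall Q : {group gT}, fusion_conjugate F P Q -> (#|'N_S(Q)| <= #|'N_S(P)|)%N.

Definition fusion_Aut (gT : finGroupType) (F : hom_family gT)
    (P : {group gT}) : {set {perm gT}} :=
  [set a in Aut P | F P P a].

Definition conj_Aut (gT : finGroupType) (S P : {group gT}) : {set {perm gT}} :=
  conj_aut P @* 'N_S(P).

(* N_f = { g in N_S(P) | f c_g f^-1 \in Aut_S(f(P)) } *)
Definition extender_set (gT : finGroupType) (S P : {group gT})
    (f : gT -> gT) : {set gT} :=
  [set g in 'N_S(P) | [exists h in 'N_S(f @: P),
                        [forall x in P, f (x ^ g) == f x ^ h]]].

Lemma extender_group_set gT S P f : group_set (@extender_set gT S P f).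
Proof.
apply/group_setP; split=> [|g g'].
  rewrite inE group1; apply/exists_inP; exists 1; first exact: group1.
  by apply/forall_inP=> x _; rewrite !conjg1.
move=> /setIdP[Ng /exists_inP[h Nh /forall_inP fh]].
move=> /setIdP[Ng' /exists_inP[h' Nh' /forall_inP fh']].
have /setIP[_ nPg] := Ng; rewrite inE groupM //=.
apply/exists_inP; exists (h * h'); first exact: groupM.
apply/forall_inP=> x Px; rewrite !conjgM (eqP (fh' _ _)) ?(eqP (fh _ _)) //.
by rewrite memJ_norm.
Qed.
Canonical extender_group gT S P f := Group (@extender_group_set gT S P f).

Record is_saturated (p : nat) (gT : finGroupType) (S : {group gT})
    (F : hom_family gT) : Prop := IsSaturated {
  saturated_sylow : forall P : {group gT}, fully_normalized S F P ->
    fully_centralized S F P /\ p.-Sylow(fusion_Aut F P) (conj_Aut S P);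
  saturated_ext : forall (P Q : {group gT}) f,
    F P S f -> Q = f @: P :> {set gT} -> fully_centralized S F Q ->
    exists2 f', F (extender_group S P f) S f' & {in P, f' =1 f}
}.

(* O^p(A): the normal subgroups of p-power index are closed under
   intersection, so that their intersection is the smallest of them. *)
Definition p_residual (p : nat) (gT : finGroupType) (A : {set gT}) : {set gT} :=
  \bigcap_(N : {group gT} | (N <| A) && p.-nat #|A : N|) N.

Definition aut_commg (gT : finGroupType) (P : {set gT}) (A : {set {perm gT}}) :
    {set gT} :=
  <<[set x^-1 * a x | x : gT in P, a : {perm gT} in A]>>.

Definition hyperfocal (p : nat) (gT : finGroupType) (S : {group gT})
    (F : hom_family gT) : {group gT} :=
  <<\bigcup_(P : {group gT} | P \subset S)
      aut_commg P (p_residual p (fusion_Aut F P))>>%G.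

(* The join; it is the product set by elementary_focalE. *)
Definition elementary_focal (p : nat) (gT : finGroupType) (S : {group gT})
    (F : hom_family gT) : {group gT} :=
  ('Phi(S) <*> hyperfocal p S F)%G.

Section FocalTheory.
Variables (p : nat) (gT : finGroupType) (S : {group gT}) (F : hom_family gT).
Hypothesis fusF : is_fusion_system S F.

Lemma fusion_Aut_group_set (P : {group gT}) :
  P \subset S -> group_set (fusion_Aut F P).
Proof.
move=> sPS; apply/group_setP; split=> [|a b].
  rewrite inE group1; have := fusion_conj fusF sPS sPS (group1 S).
  rewrite conjsg1 => /(_ (subxx _)); congr is_true; apply: (fusion_ext fusF).
  by move=> x _; rewrite perm1 conjg1.
move=> /setIdP[Aa Fa] /setIdP[Ab Fb]; rewrite inE groupM //=.
have := fusion_comp fusF Fa Fb; congr is_true; apply: (fusion_ext fusF).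
by move=> x _; rewrite permM.
Qed.

Lemma hyperfocal_sub : hyperfocal p S F \subset S.
Proof.
rewrite gen_subG; apply/bigcupsP=> P sPS; rewrite gen_subG.
apply/subsetP=> _ /imset2P[x a Px Aa ->].
pose A := Group (fusion_Aut_group_set sPS).
have nAA : (A <| A) && p.-nat #|A : A| by rewrite normal_refl indexgg.
have /bigcapP/(_ A nAA) := Aa.
case/setIdP=> AutPa _; apply: (subsetP sPS).
by rewrite groupM ?groupV // Aut_closed.
Qed.

Lemma elementary_focalE :
  elementary_focal p S F = 'Phi(S) * hyperfocal p S F :> {set gT}.
Proof.
rewrite /= norm_joinEr //.
exact: subset_trans hyperfocal_sub (gFnorm _ _).
Qed.

End FocalTheory.

Definition fusion_quotient (gT : finGroupType) (F : hom_family gT)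
    (T : {group gT}) : hom_family (coset_of T) :=
  fun PT QT f =>
    [exists P : {group gT}, exists Q : {group gT}, exists h : {ffun gT -> gT},
      [&& T \subset P, T \subset Q, PT == (P / T)%G, QT == (Q / T)%G, F P Q h
        & [forall x in P, f (coset T x) == coset T (h x)]]].

Arguments fusion_quotient {gT} F T PT QT f.

Definition strongly_closed (gT : finGroupType) (S : {group gT})
    (F : hom_family gT) (T : {group gT}) : Prop :=
  T \subset S /\
  forall (P : {group gT}) f, P \subset T -> F P S f -> f @: P \subset T.

Section QuotientTheory.
Variables (gT : finGroupType) (S T : {group gT}) (F : hom_family gT).
Hypotheses (fusF : is_fusion_system S F) (closedT : strongly_closed S F T).

Lemma strongly_closed_normal : T <| S.
Proof.
have [sTS clT] := closedT; rewrite /normal sTS; apply/subsetP=> s Ss.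
rewrite inE; have := clT T (conjg^~ s) (subxx _); apply.
by apply: (fusion_conj fusF) => //; rewrite conj_subG.
Qed.
Let nTS : S \subset 'N(T) := normal_norm strongly_closed_normal.

Lemma fusion_incl (P Q : {group gT}) :
  P \subset Q -> Q \subset S -> F P Q id.
Proof.
move=> sPQ sQS; have sPS := subset_trans sPQ sQS.
rewrite (@fusion_ext _ _ _ fusF _ _ _ (conjg^~ 1)) => [|x _]; last by rewrite conjg1.
by apply: (fusion_conj fusF) => //; rewrite conjsg1.
Qed.

Lemma strongly_closed_im (P Q : {group gT}) f :
  T \subset P -> F P Q f -> f @: T = T.
Proof.
move=> sTP Ff; have [_ clT] := closedT.
have [sPS sQS] := fusion_obj fusF Ff; have [_ injf _] := fusion_inj fusF Ff.
have FfS : F T S f.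
  exact: (fusion_comp fusF (fusion_comp fusF (fusion_incl sTP sPS) Ff)
    (fusion_incl sQS (subxx _))).
apply/eqP; rewrite eqEcard (clT _ _ (subxx _) FfS) card_in_imset ?leqnn //.
by move=> x y Tx Ty; apply: injf; apply: (subsetP sTP).
Qed.

Lemma fusion_quotientP (PT QT : {group coset_of T}) f :
  reflect (exists P Q : {group gT}, exists h, [/\ T \subset P, T \subset Q,
             PT = (P / T)%G, QT = (Q / T)%G
           & F P Q h /\ {in P, forall x, f (coset T x) = coset T (h x)}])
          (fusion_quotient F T PT QT f).
Proof.
apply: (iffP existsP) => [[P /existsP[Q /existsP[h]]]|[P [Q [h]]]].
  case/and5P=> sTP sTQ /eqP-> /eqP-> /andP[Fh /forall_inP fh].
  by exists P, Q, h; split=> //; split=> // x Px; apply/eqP/fh.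
case=> sTP sTQ -> -> [Fh fh]; exists P; apply/existsP; exists Q.
apply/existsP; exists [ffun x => h x]; rewrite sTP sTQ !eqxx /=.
rewrite (@fusion_ext _ _ _ fusF _ _ _ h) => [|x _]; last by rewrite ffunE.
by rewrite Fh; apply/forall_inP=> x Px; rewrite ffunE fh.
Qed.

Lemma quotient_fusion_system :
  is_fusion_system (S / T)%G (fusion_quotient F T).
Proof.
have nT (P : {group gT}) : P \subset S -> P \subset 'N(T).
  by move=> sPS; apply: subset_trans nTS.
have pre (PT : {group coset_of T}) : PT \subset S / T ->
    exists P : {group gT}, [/\ T \subset P, P \subset S & PT = (P / T)%G].
  move=> sPS; exists (coset T @*^-1 PT)%G; split=> /=.
  - exact: sub_cosetpre.
  - by rewrite -(quotientGK strongly_closed_normal) cosetpreSK.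
  - by apply: val_inj; rewrite /= cosetpreK.
have eqQ (P Q : {group gT}) : P \subset S -> Q \subset S ->
    T \subset P -> T \subset Q -> (P / T)%G = (Q / T)%G -> P = Q.
  move=> sPS sQS sTP sTQ /(congr1 val) /= ePQ; apply: val_inj => /=.
  by apply: quotient_inj ePQ; apply/andP; split=> //; apply: nT.
split.
- move=> PT QT f /fusion_quotientP[P [Q [h [_ _ -> -> [Fh _]]]]].
  by have [sPS sQS] := fusion_obj fusF Fh; rewrite !quotientS.
- have ext (PT QT : {group coset_of T}) f g : {in PT, f =1 g} ->
      fusion_quotient F T PT QT f -> fusion_quotient F T PT QT g.
    move=> fg /fusion_quotientP[P [Q [h [sTP sTQ eP eQ [Fh fh]]]]].
    apply/fusion_quotientP; exists P, Q, h; split=> //; split=> // x Px.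
    by rewrite -fg ?fh // eP mem_quotient.
  move=> PT QT f g fg; apply/idP/idP; apply: ext => // x Px.
  by rewrite fg.
- move=> PT QT f /fusion_quotientP[P [Q [h [sTP sTQ -> -> [Fh fh]]]]].
  have [sPS sQS] := fusion_obj fusF Fh; have [hM injh sh] := fusion_inj fusF Fh.
  have hQ x : x \in P -> h x \in Q.
    by move=> Px; rewrite (subsetP sh) ?imset_f.
  have [nP nQ] := (subsetP (nT P sPS), subsetP (nT Q sQS)).
  split.
  + move=> _ _ /morphimP[x Nx Px ->] /morphimP[y Ny Py ->].
    by rewrite -morphM // !fh ?groupM // hM // morphM ?nQ ?hQ.
  + move=> _ _ /morphimP[x Nx Px ->] /morphimP[y Ny Py ->].
    rewrite !fh // => /kercoset_rcoset[]; rewrite ?nQ ?hQ // => u Tu.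
    have: u \in h @: T by rewrite (strongly_closed_im sTP Fh).
    case/imsetP=> t Tt ->.
    have Pt := subsetP sTP _ Tt.
    rewrite -hM // => /injh ->; rewrite ?groupM //.
    exact: coset_kerl.
  + apply/subsetP=> _ /imsetP[_ /morphimP[x Nx Px ->] ->].
    by rewrite fh // mem_quotient ?hQ.
- move=> _ _ _ /pre[P [sTP sPS ->]] /pre[Q [sTQ sQS ->]] /morphimP[s Ns Ss ->] sPQ.
  apply/fusion_quotientP; exists P, Q, (conjg^~ s); split=> //; split.
    apply: (fusion_conj fusF) => //.
    have: P :^ s / T \subset Q / T by rewrite quotientJ.
    have sPsS : P :^ s \subset S by rewrite conj_subG.
    rewrite quotientSK; last exact: subset_trans sPsS nTS.
    move=> /subset_trans; apply.
    by rewrite mul_subG.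
  by move=> x Px; rewrite morphJ // (subsetP (nT P sPS)).
- move=> PT QT RT f g /fusion_quotientP[P [Q [h [sTP sTQ -> -> [Fh fh]]]]].
  move=> /fusion_quotientP[Q' [R [k [sTQ' sTR eQ -> [Fk gk]]]]].
  have [sPS sQS] := fusion_obj fusF Fh; have [sQS' sRS] := fusion_obj fusF Fk.
  have [_ _ sh] := fusion_inj fusF Fh.
  have {}eQ : Q = Q' by apply: eqQ. subst Q'.
  apply/fusion_quotientP; exists P, R, (k \o h); split=> //; split.
    exact: (fusion_comp fusF Fh).
  by move=> x Px; rewrite /= fh // gk // (subsetP sh) ?imset_f.
- move=> PT QT f /fusion_quotientP[P [Q [h [sTP sTQ -> -> [Fh fh]]]]].
  have [R sRQ [FhR [k [Fk hk kh]]]] := fusion_fact fusF Fh.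
  have sTR : T \subset R.
    rewrite -(strongly_closed_im sTP Fh); have [_ _] := fusion_inj fusF FhR.
    by apply: subset_trans; rewrite imsetS.
  have [_ _ sk] := fusion_inj fusF Fk; have [_ _ shR] := fusion_inj fusF FhR.
  have [sRS sPS] := fusion_obj fusF Fk.
  exists (R / T)%G; first exact: quotientS.
  split; first by apply/fusion_quotientP; exists P, R, h; split.
  have kT x y : x \in R -> y \in R -> coset T x = coset T y ->
      coset T (k x) = coset T (k y).
    move=> Rx Ry /kercoset_rcoset[]; rewrite ?(subsetP (nT R sRS)) // => u Tu ->.
    have [kM _ _] := fusion_inj fusF Fk.
    have Ru := subsetP sTR _ Tu; rewrite kM // coset_kerl //.
    by have := imset_f k Tu; rewrite (strongly_closed_im sTR Fk).
  have reprR xT : xT \in R / T -> repr xT \in R.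
    case/morphimP=> x Nx Rx ->; have := coset_reprK (coset T x).
    move=> /kercoset_rcoset[]; rewrite ?repr_coset_norm // => u Tu ->.
    by rewrite groupM // (subsetP sTR).
  exists (fun xT : coset_of T => coset T (k (repr xT))); split.
  + apply/fusion_quotientP; exists R, P, k; split=> //; split=> // x Rx.
    by apply: kT; rewrite ?coset_reprK // reprR // mem_quotient.
  + move=> _ /morphimP[x Nx Px ->]; rewrite fh //.
    have Rhx : h x \in R by rewrite (subsetP shR) ?imset_f.
    rewrite -{2}(hk x) //; apply: kT; rewrite ?coset_reprK //.
    by rewrite reprR // mem_quotient.
  + move=> xT RxT; have Rx := reprR _ RxT.
    by rewrite fh ?(subsetP sk) ?imset_f // kh // coset_reprK.
Qed.

End QuotientTheory.

Definition subg_map (gT rT : finGroupType) (P : {group gT}) (Q : {group rT})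
    (f : gT -> rT) : [subg P] -> [subg Q] :=
  fun x => subg Q (f (sgval x)).
Arguments subg_map {gT rT} P Q f x.

(* subg_map P S id is the inclusion of P in S, so its pullback is res. *)
Definition fusion_cohomology (p n : nat) (gT : finGroupType) (S : {group gT})
    (F : hom_family gT) : {pred cohomology p n [subg S]} :=
  fun z =>
    [forall P : {group gT}, forall f : {ffun gT -> gT}, F P S f ==>
      (cohomology_pullback (subg_map P S id) z
         == cohomology_pullback (subg_map P S f) z)].
Arguments fusion_cohomology p n {gT} S F z.

Definition inflation (p n : nat) (gT : finGroupType) (S T : {group gT}) :
    cohomology p n [subg (S / T)] -> cohomology p n [subg S] :=
  cohomology_pullback (subg_map S (S / T) (coset T)).
Arguments inflation p n {gT} S T x.

(* Main.v *)
(* Put H = O^p_F(S) and E = Phi(S)H.  By Alperin's argument every morphism of F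
   moves elements only within their cosets of E, so F/E contains only
   inclusions and every class of H^2(S/E) is F/E-stable; hence inflation is
   injective on H^2(S/E).  If S/H is not elementary abelian then E > H, and
   there is a nonzero S-invariant character chi : E -> F_p trivial on H.  Its
   transgression in H^2(S/E) inflates to 0 in H^2(S), so it vanishes and chi
   extends to a homomorphism S -> F_p.  The extension kills both Phi(S) and H,
   hence E: a contradiction. *)
Require Import Defs.
From mathcomp Require Import all_boot all_order all_fingroup all_algebra.
From mathcomp Require Import all_solvable ring.

Set Implicit Arguments.
Unset Strict Implicit.
Unset Printing Implicit Defensive.

Local Open Scope group_scope.

Import GRing.Theory.

(** * Low-degree cochains and the extension of invariant characters *)

Lemma differential1E p (G : finGroupType) (b : cochain p 1 G) (x y : G) :
  differential b [tuple x; y]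
    = (b [tuple y] - b [tuple (x * y)%g] + b [tuple x])%R.
Proof.
rewrite ffunE !big_ord_recl big_ord0 /= expr0 expr1 mul1r mulN1r addr0 addrA.
rewrite expr2 mulN1r opprK mul1r.
by congr (b _ - b _ + b _)%R; apply: eq_from_tnth => -[[|j] //= lt_j];
  rewrite tnth_mktuple /tnth.
Qed.

Lemma differential2E p (G : finGroupType) (c : cochain p 2 G) (x y z : G) :
  differential c [tuple x; y; z]
    = (c [tuple y; z] - c [tuple (x * y)%g; z] + c [tuple x; (y * z)%g]
       - c [tuple x; y])%R.
Proof.
rewrite ffunE !big_ord_recl big_ord0 /= expr0 expr1 mul1r mulN1r addr0 !addrA.
rewrite /bump /= (exprS _ 2) !sqrrN !expr1n mulr1 mul1r mulN1r.
by congr (c _ - c _ + c _ - c _)%R; apply: eq_from_tnth => -[[|[|j]] //= lt_j];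
  rewrite tnth_mktuple /tnth.
Qed.

Lemma cohomology_class_eq p n (G : finGroupType) (z t : cocycle p n G) :
  (cohomology_class z == cohomology_class t) = (z - t \in @coboundary_pred p n G)%R.
Proof. by rewrite Quotient.idealrBE. Qed.

Lemma coboundary2P p (G : finGroupType) (z : cocycle p 2 G) :
  reflect (exists b : G -> 'F_p, forall x y,
             cocycle_val z [tuple x; y] = (b y - b (x * y)%g + b x)%R)
          (z \in @coboundary_pred p 2 G).
Proof.
rewrite unfold_in; case: z => z /= _; apply: (iffP existsP) => [[b /eqP zb]|[b zb]].
  exists (fun x => b [tuple x]) => x y.
  by rewrite zb differential1E.
exists [ffun t => b (tnth t ord0)]; apply/eqP/ffunP=> t.
have -> : t = [tuple tnth t ord0; tnth t ord_max].
  by apply: eq_from_tnth => -[[|[|j]] //= lt_j]; rewrite /tnth /=;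
    apply: set_nth_default; rewrite size_tuple.
by rewrite zb differential1E !ffunE.
Qed.

(* The cocycle c used below is the transgression of chi, i.e. the class of the
   extension of H by ker f pushed out along chi; it pulls back to - d b. *)
Lemma hom_extension p (G H : finGroupType) (f : G -> H) (chi : G -> 'F_p) :
    {morph f : x y / x * y} -> (forall h, exists g, f g = h) ->
    (forall x y, f x = 1 -> f y = 1 -> chi (x * y)%g = (chi x + chi y)%R) ->
    (forall x g, f x = 1 -> chi (x ^ g) = chi x) ->
    injective (@cohomology_pullback p 2 G H f) ->
  exists2 psi : G -> 'F_p, {morph psi : x y / x * y >-> (x + y)%R}%g
    & forall x, f x = 1 -> psi x = chi x.
Proof.
move=> fM f_onto chiM chiJ f_inj.
have f1 : f 1 = 1 by apply: (mulgI (f 1)); rewrite -fM !mulg1.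
have fV x : f x^-1 = (f x)^-1.
  by apply: (mulgI (f x)); rewrite -fM !mulgV.
(* [s] is a set-theoretic section of [f]; it need not send 1 to 1. *)
pose s h := odflt 1 [pick g | f g == h].
have sK h : f (s h) = h.
  rewrite /s; case: pickP => [g /eqP //|no_g].
  by have [g fg] := f_onto h; case/eqP: (no_g g).
pose b g := chi (g * (s (f g))^-1).
pose c h k := b (s h * s k).
have bM x y : b (x * y) = (b x + b y + c (f x) (f y))%R.
  rewrite /c /b !fM !sK.
  (* Each of the three factors lies in the kernel of [f], where [chi] is additive and invariant
     under conjugation; the last factor contributes [c]. *)
  have -> : x * y * (s (f x * f y))^-1
     = (x * (s (f x))^-1) * ((y * (s (f y))^-1) ^ (s (f x))^-1
       * (s (f x) * s (f y) * (s (f x * f y))^-1)).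
    by rewrite conjgE invgK !mulgA !mulgKV.
  have k1 z : f (z * (s (f z))^-1) = 1 by rewrite fM fV sK mulgV.
  have kJ z t : f z = 1 -> f (z ^ t) = 1.
    by move=> fz; rewrite conjgE !fM fV fz mul1g mulVg.
  have k2 : f (s (f x) * s (f y) * (s (f x * f y))^-1) = 1.
    by rewrite !fM fV !sK mulgV.
  have chi3 u v w t : f u = 1 -> f v = 1 -> f w = 1 ->
      chi (u * (v ^ t * w)) = (chi u + chi v + chi w)%R.
    move=> fu fv fw; have fvt := kJ v t fv.
    have fvtw : f (v ^ t * w) = 1 by rewrite fM fvt fw mulg1.
    by rewrite chiM // chiM // chiJ // addrA.
  by rewrite chi3.
pose cc : cochain p 2 H := [ffun t => c (tnth t ord0) (tnth t ord_max)].
have ccE x y : cc [tuple x; y] = c x y by rewrite ffunE.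
have cc_cocycle : cc \in @cocycle_pred p 2 H.
  rewrite unfold_in; apply/eqP/ffunP=> t.
  have -> : t = [tuple tnth t ord0; tnth t (lift ord0 ord0); tnth t ord_max].
    by apply: eq_from_tnth => -[[|[|[|j]]] //= lt_j]; rewrite /tnth /=;
      apply: set_nth_default; rewrite size_tuple.
  move: (tnth t _) (tnth t _) (tnth t _) => z y x {t}.
  rewrite differential2E !ccE ffunE.
  (* Associativity: expanding [b] in two ways on a product of three values of [s] gives the cocycle
     identity. *)
  have := bM (s x * s y) (s z); rewrite -mulgA !bM !fM !sK => /eqP.
  rewrite -subr_eq0 => /eqP <-.
  by ring.
pose z := Cocycle cc_cocycle.
have : cohomology_class z == cohomology_class 0%R.
  apply/eqP/f_inj; rewrite !cohomology_pullbackE //.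
  apply/eqP; rewrite cohomology_class_eq -cocycle_pullbackB // subr0.
  apply/coboundary2P; exists (fun g => - b g)%R => x y.
  rewrite (cocycle_pullbackE fM) /= ffunE.
  have -> : map_tuple f [tuple x; y] = [tuple f x; f y] by apply: val_inj.
  by rewrite ccE bM; ring.
rewrite cohomology_class_eq subr0 => /coboundary2P[a /= za].
(* As [c] is the coboundary of [a], adding [a] composed with [f] cancels the failure of [b] to be
   additive. *)
have psiM : {morph (fun g => b g + a (f g))%R : x y / (x * y)%g >-> (x + y)%R}.
  by move=> x y /=; rewrite bM fM -ccE za; ring.
(* On the kernel, [b] differs from [chi] by the constant [chi (s 1)], because [s 1] may be
   nontrivial; evaluation at 1 then shows that [a 1] cancels this constant. *)
have psiE x : f x = 1 -> (b x + a (f x) = chi x + (a 1%g - chi (s 1%g)))%R.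
  move=> fx; have fs1 : f (s 1) = 1 by rewrite sK.
  have fxs : f (x * (s 1)^-1) = 1 by rewrite fM fV fx fs1 mulgV.
  by rewrite /b fx -{2}(mulgKV (s 1) x) (chiM _ (s 1)) //; ring.
have a1 : (a 1%g - chi (s 1%g) = 0)%R.
  have idem0 (u : 'F_p) : (u = u + u -> u = 0)%R.
    by move=> e; apply: (addrI u); rewrite addr0 -e.
  have chi1 : chi 1 = 0%R by apply: idem0; rewrite -chiM ?mulg1.
  have := psiE 1 f1; rewrite chi1 add0r => <-.
  by apply: idem0; have /= := psiM 1 1; rewrite mulg1.
by exists (fun g => b g + a (f g))%R => // x fx; rewrite psiE // a1 addr0.
Qed.

(** * Subgroups containing the [p]-residual *)

(** In each [p]-group quotient [A / N] the image of [a] is both a [p]-element and a [p']-element,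
    hence trivial. *)
Lemma p'_elt_residual (p : nat) (gT : finGroupType) (A : {group gT}) a :
  a \in A -> p^'.-elt a -> a \in p_residual p A.
Proof.
move=> Aa p'a; apply/bigcapP=> N /andP[/andP[_ nNA] pAN].
have Na := subsetP nNA a Aa.
rewrite coset_idr //; apply/eqP; rewrite -order_eq1; apply/eqP.
apply: (@pnat_1 p); last exact: morph_p_elt.
by apply: mem_p_elt (mem_quotient N Aa); rewrite /pgroup card_quotient.
Qed.

(** The orders are compared one prime at a time: [P] accounts for [p], and for any other prime a
    Sylow subgroup consists of [p']-elements, so it lies in the residual. *)
Lemma residual_Sylow_eq (p : nat) (gT : finGroupType) (A B P : {group gT}) :
    p.-Sylow(A) P -> P \subset B -> B \subset A -> p_residual p A \subset B ->
  B :=: A.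
Proof.
move=> sylP sPB sBA sRB; apply/eqP; rewrite eqEcard sBA dvdn_leq //.
apply/(dvdn_partP _ (cardG_gt0 A)) => q _; have [->|neq_qp] := eqVneq q p.
  by rewrite -(card_Hall sylP) cardSg.
have [Q sylQ] := Sylow_exists q A; rewrite -(card_Hall sylQ) cardSg //.
apply: subset_trans sRB; apply/subsetP=> x Qx.
apply: p'_elt_residual; first exact: subsetP (pHall_sub sylQ) x Qx.
apply: sub_in_pnat (mem_p_elt (pHall_pgroup sylQ) Qx) => r _.
by rewrite !inE => /eqP->.
Qed.

Lemma p_residualJ (p : nat) (gT : finGroupType) (A : {group gT}) a c :
  a \in p_residual p A -> a ^ c \in p_residual p (A :^ c).
Proof.
move=> Ra; apply/bigcapP=> N /andP[nNA pAN].
rewrite -[N : {set gT}](conjsgKV c) memJ_conjg; move/bigcapP: Ra; apply.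
by rewrite -(normalJ _ _ c) -(indexJg _ _ c) !conjsgKV nNA.
Qed.

(** * Isomorphisms in a fusion system and their extension to normalizers *)

Section Fusion.
Variables (gT : finGroupType) (S : {group gT}) (F : hom_family gT).
Hypothesis fusF : is_fusion_system S F.

(** The factorization axiom provides an inverse on the image of [f], which is all of [Q] as soon as
    [f] is onto. *)
Lemma fusion_isoP (P Q : {group gT}) f :
  fusion_iso F P Q f <-> F P Q f /\ f @: P = Q.
Proof.
split=> [[Ff [g [Fg fK gK]]]|[Ff fP]].
  split=> //; have [_ _ sfQ] := fusion_inj fusF Ff.
  have [_ _ sgP] := fusion_inj fusF Fg.
  apply/eqP; rewrite eqEsubset sfQ; apply/subsetP=> y Qy.
  by rewrite -(gK y Qy) imset_f // (subsetP sgP) ?imset_f.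
have [R _ isoR] := fusion_fact fusF Ff; case: (isoR) => FfR [g [Fg fK gK]].
suff -> : Q = R by [].
apply/val_inj/eqP; rewrite eqEsubset /= -fP; apply/andP; split.
  by have [_ _] := fusion_inj fusF FfR.
apply/subsetP=> y Ry; rewrite fP -(gK y Ry).
have [_ _ sgP] := fusion_inj fusF Fg.
by rewrite -fP imset_f // (subsetP sgP) ?imset_f.
Qed.

Lemma fusion_iso_comp (P Q R : {group gT}) f g :
  fusion_iso F P Q f -> fusion_iso F Q R g -> fusion_iso F P R (g \o f).
Proof.
move=> /fusion_isoP[Ff fP] /fusion_isoP[Fg gQ]; apply/fusion_isoP.
by split; [apply: (fusion_comp fusF Ff) | rewrite imset_comp fP gQ].
Qed.

Lemma fusion_iso_sym (P Q : {group gT}) f :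
  fusion_iso F P Q f ->
  exists2 g, fusion_iso F Q P g & {in P, cancel f g} /\ {in Q, cancel g f}.
Proof.
by move=> [Ff [g [Fg fK gK]]]; exists g => //; split=> //; exists f.
Qed.

Lemma fusion_iso_id (P : {group gT}) : P \subset S -> fusion_iso F P P id.
Proof.
by move=> sPS; apply/fusion_isoP; rewrite imset_id; split=> //;
  apply: (fusion_incl fusF).
Qed.

Lemma fusion_restr (P Q R : {group gT}) f :
  F Q R f -> P \subset Q -> F P S f.
Proof.
move=> Ff sPQ; have [sQS sRS] := fusion_obj fusF Ff.
apply: (fusion_comp fusF (fusion_incl fusF sPQ sQS)).
exact: (fusion_comp fusF Ff (fusion_incl fusF sRS (subxx S))).
Qed.

Lemma fusion_image (P : {group gT}) f : F P S f ->
  exists Q : {group gT}, fusion_iso F P Q f.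
Proof. by case/(fusion_fact fusF) => Q _; exists Q. Qed.

(** Passes from a function that matters only on [P] to a permutation trivial outside [P], as
    membership in [Aut P] demands. *)
Lemma fusion_iso_Aut (P : {group gT}) f : fusion_iso F P P f ->
  exists2 a, a \in fusion_Aut F P & {in P, a =1 f}.
Proof.
move=> /fusion_isoP[Ff fP]; have [fM inj_f _] := fusion_inj fusF Ff.
have inj_m : 'injm (Morphism fM) by apply/injmP.
have im_m : Morphism fM @* P = P by rewrite morphimEdom.
exists (aut inj_m im_m) => [|x Px]; last exact: autE.
rewrite inE Aut_aut -(@fusion_ext _ _ _ fusF _ _ f) // => x Px.
by rewrite autE.
Qed.

Lemma fully_normalized_exists (P : {group gT}) : P \subset S ->
  exists Q f, fully_normalized S F Q /\ fusion_iso F P Q f.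
Proof.
move=> sPS.
(* A boolean form of conjugacy to [P], so that a conjugate with largest normalizer can be picked. *)
pose conjP (Q : {group gT}) :=
  [exists f : {ffun gT -> gT}, F P Q f && (f @: P == Q)].
have conjPP Q : reflect (exists f, fusion_iso F P Q f) (conjP Q).
  apply: (iffP existsP) => [[f /andP[Ff /eqP fP]]|[f /fusion_isoP[Ff fP]]].
    by exists f; apply/fusion_isoP.
  exists (finfun f); rewrite -(@fusion_ext _ _ _ fusF _ _ f) => [|x _];
    last by rewrite ffunE.
  by rewrite Ff -fP; apply/eqP/eq_imset => x; rewrite ffunE.
have PP : conjP P by apply/conjPP; exists id; apply: fusion_iso_id.
case: (arg_maxnP (fun Q : {group gT} => #|'N_S(Q)|) PP) => Q /conjPP[f isoQ] maxQ.
exists Q, f; split=> //; split; first by have [/(fusion_obj fusF)[]] := isoQ.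
by move=> R [g isoR]; apply/maxQ/conjPP; exists (g \o f);
  apply: fusion_iso_comp isoR.
Qed.


(** Transport along [f] turns the automorphisms of [P] induced by [S] into a [p]-subgroup of the
    automizer of [Q], where those induced by [S] form a Sylow subgroup. Twisting [f] by an
    automorphism of [Q] moves one inside the other, and saturation then extends the twisted map to
    the whole normalizer. The extension need not restrict to [f]; only the image of [P] is kept. *)
Lemma fully_normalized_extension (p : nat) (P Q : {group gT}) f :
    p.-group S -> is_saturated p S F -> fully_normalized S F Q ->
    fusion_iso F P Q f ->
  exists h (R : {group gT}), fusion_iso F 'N_S(P) R h /\ h @: P = Q.
Proof.
move=> pS satF nQ isoPQ; have [Ff fP] := (fusion_isoP P Q f).1 isoPQ.
have [g isoQP [fK gK]] := fusion_iso_sym isoPQ; have [Fg gQ] :=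
  (fusion_isoP _ _ _).1 isoQP.
have [sPS sQS] := fusion_obj fusF Ff; have [fM inj_f _] := fusion_inj fusF Ff.
pose m := Morphism fM; have inj_m : 'injm m by apply/injmP.
have mP : m @* P = Q by rewrite morphimEdom.
have [cQ sylQ] := saturated_sylow satF nQ.
pose A := Group (fusion_Aut_group_set fusF sQS).
pose phi := Aut_isom inj_m (subxx P).
have conjP s x : s \in 'N_S(P) -> x \in P -> conj_aut P s x = x ^ s.
  by case/setIP=> _ nPs Px; apply: norm_conj_autE.
have phiE s x : s \in 'N_S(P) -> x \in P -> phi (conj_aut P s) (f x) = f (x ^ s).
  by move=> NSs Px; rewrite /phi (Aut_isomE inj_m) ?Aut_aut //= conjP.
pose B := (phi @* conj_Aut S P)%G.
have sBA : B \subset A.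
  apply/subsetP=> _ /morphimP[_ _ /morphimP[s Ns NSs ->] ->].
  rewrite inE -mP Aut_Aut_isom /=.
  have [Ss nPs] := setIP NSs.
  rewrite -(@fusion_ext _ _ _ fusF _ _ ((f \o conjg^~ s) \o g)).
    apply: (fusion_comp fusF Fg); apply: (fusion_comp fusF _ Ff).
    by apply: (fusion_conj fusF) => //; rewrite (normP nPs).
  move=> y Qy; have Py : g y \in P by rewrite -gQ imset_f.
  by have := phiE s (g y) NSs Py; rewrite gK.
have pB : p.-group B.
  by do 2!apply: morphim_pgroup; apply: pgroupS (subsetIl _ _) pS.
(* Sylow conjugacy yields the twist: [f] will be followed by [a^-1]. *)
have [a Aa sBa] := Sylow_subJ (G := A) sylQ sBA pB.
have /setIdP[_ Fa] : a^-1 \in A by rewrite groupV.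
have isoa : fusion_iso F Q Q a^-1.
  apply/fusion_isoP; split=> //; have [_ inj_a sa] := fusion_inj fusF Fa.
  by apply/eqP; rewrite eqEcard sa card_in_imset /=.
have isof1 := fusion_iso_comp isoPQ isoa.
have [Ff1 f1P] := (fusion_isoP _ _ _).1 isof1.
have [|h Fh hf1] := saturated_ext satF (Q :=
  Q) (fusion_restr Ff1 (subxx P)) _ cQ.
  by rewrite f1P.
have sNh : 'N_S(P) \subset extender_group S P (a^-1 \o f).
  apply/subsetP=> s NSs; rewrite inE NSs /=.
  have : phi (conj_aut P s) \in conj_Aut S Q :^ a.
    apply: (subsetP sBa); apply: mem_morphim; first exact: Aut_aut.
    by apply: mem_morphim => //; case/setIP: NSs.
  case/imsetP=> _ /morphimP[t Nt NSt ->] def_s.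
  apply/exists_inP; exists t; first by rewrite f1P.
  apply/forall_inP=> x Px /=; rewrite -phiE // def_s.
  have Qax : a^-1 (f x) \in Q by rewrite -f1P; apply: (imset_f (a^-1 \o f)).
  by rewrite conjgE !permM permK norm_conj_autE.
have [R isoR] := fusion_image (fusion_restr Fh sNh).
exists h, R; split=> //; rewrite -f1P; apply: eq_in_imset => x Px.
exact: hf1.
Qed.

(** * Displacement of elements by morphisms *)

Lemma residual_moves_in_hyperfocal (p : nat) (P : {group gT}) x a :
    P \subset S -> x \in P -> a \in p_residual p (fusion_Aut F P) ->
  x^-1 * a x \in hyperfocal p S F.
Proof.
move=> sPS Px Ra; apply: mem_gen; apply/bigcupP; exists P => //.
by apply: mem_gen; apply/imset2P; exists x a.
Qed.

(** The automorphisms moving elements only within cosets of [E] form a subgroup. It contains the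
    Sylow subgroup induced by [S], whose displacements are commutators, and the [p]-residual, whose
    displacements are hyperfocal; so it is everything. *)
Lemma fully_normalized_Aut_focal (p : nat) (E Q : {group gT}) a x :
    is_saturated p S F -> S^`(1) \subset E -> hyperfocal p S F \subset E ->
    fully_normalized S F Q -> a \in fusion_Aut F Q -> x \in Q ->
  x^-1 * a x \in E.
Proof.
move=> satF sS'E sHE nQ Aa Qx; have [sQS _] := nQ.
have [_ sylQ] := saturated_sylow satF nQ.
pose A := Group (fusion_Aut_group_set fusF sQS).
pose B := [set b in A | [forall y in Q, y^-1 * b y \in E]].
have gB : group_set B.
  apply/group_setP; split=> [|b c].
    by rewrite inE group1; apply/forall_inP=> y _; rewrite perm1 mulVg.
  move=> /setIdP[Ab /forall_inP Eb] /setIdP[Ac /forall_inP Ec].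
  rewrite inE groupM //; apply/forall_inP=> y Qy; rewrite permM.
  have Qby : b y \in Q by case/setIdP: Ab => Autb _; apply: Aut_closed.
  by have := groupM (Eb y Qy) (Ec _ Qby); rewrite mulgA mulgK.
have sBA : B \subset A by apply/subsetP=> b /setIdP[].
have AB : Group gB :=: A.
  apply: (@residual_Sylow_eq p _ A (Group gB) _ sylQ) => //.
    apply/subsetP=> _ /morphimP[s _ NSs ->].
    rewrite inE (subsetP (pHall_sub sylQ)) ?mem_morphim //=; last
      by case/setIP: NSs.
    have [Ss nQs] := setIP NSs; apply/forall_inP=> y Qy.
    by rewrite norm_conj_autE // (subsetP sS'E) // mem_commg // (subsetP sQS).
  apply/subsetP=> b Rb.
  have Ab : b \in A.
    have nAA : (A <| A) && p.-nat #|A : A| by rewrite normal_refl indexgg.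
    by have /bigcapP/(_ A nAA) := Rb.
  rewrite inE Ab; apply/forall_inP=> y Qy; apply: (subsetP sHE).
  exact: residual_moves_in_hyperfocal Rb.
by have : a \in A by []; rewrite -AB => /setIdP[_ /forall_inP->].
Qed.

(* Alperin's argument: a morphism out of P is, up to the extensions to N_S(P)
   and N_S(h(P)) of isomorphisms onto a fully normalized Q, an
   automorphism of Q; the extensions are covered by induction. *)
Lemma focal_sub (p : nat) (E P : {group gT}) h x :
    p.-group S -> is_saturated p S F ->
    S^`(1) \subset E -> hyperfocal p S F \subset E ->
    F P S h -> x \in P ->
  x^-1 * h x \in E.
Proof.
move=> pS satF sS'E sHE.
(* Downward induction on the order of [P]. *)
have [n] := ubnP (#|S| - #|P|); elim: n => // n IHn in P h x *.
move=> lePn Fh Px; have [sPS _] := fusion_obj fusF Fh.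
have AutE := fully_normalized_Aut_focal satF sS'E sHE.
have [eqPS|neqPS] := eqVneq (P : {set gT}) S.
  have {}eqPS : P = S by apply: val_inj.
  subst P; have isoh : fusion_iso F S S h.
    have [_ inj_h sh] := fusion_inj fusF Fh; apply/fusion_isoP; split=> //.
    by apply/eqP; rewrite eqEcard card_in_imset // leqnn sh.
  have [a Aa <-//] := fusion_iso_Aut isoh; apply: (AutE S) => //.
  (* [S] is fully normalized, since no normalizer in [S] exceeds [S]. *)
  split=> // Q [f /fusion_isoP[Ff _]]; rewrite (setIidPl (normG S)).
  exact: subset_leq_card (subsetIl _ _).
(* A proper subgroup of a [p]-group is smaller than its normalizer, so the induction hypothesis
   covers the extension to ['N_S(R)]. *)
have ext (R Q : {group gT}) f : #|R| = #|P| -> R \subset S ->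
    fully_normalized S F Q -> fusion_iso F R Q f ->
    exists2 k, fusion_iso F R Q k & {in R, forall y, y^-1 * k y \in E}.
  move=> cardR sRS nQ isof.
  have ltRS : R \proper S.
    by rewrite properEcard sRS cardR proper_card // properEneq neqPS.
  have [k [T [isok kR]]] := fully_normalized_extension pS satF nQ isof.
  have sRN : R \subset 'N_S(R) by rewrite subsetI sRS normG.
  have [Fk _] := isok.
  exists k => [|y Ry].
    have [Q' isoQ'] := fusion_image (fusion_restr Fk sRN).
    suff -> : Q = Q' by []; apply: val_inj; rewrite /= -kR.
    by case/fusion_isoP: isoQ'.
  apply: (IHn 'N_S(R)%G) => //; last exact: subsetP sRN y Ry.
    have ltRN := proper_card (nilpotent_proper_norm (pgroup_nil pS) ltRS).
    apply: leq_trans (ltnSE lePn); rewrite -cardR ltn_sub2l //.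
    exact: proper_card.
  exact: fusion_restr Fk (subxx _).
have [hP isoh] := fusion_image Fh.
have [Q [f [nQ isof]]] := fully_normalized_exists sPS.
have [k isok Ek] := ext P Q f erefl sPS nQ isof.
have [h' isoh' [hK h'K]] := fusion_iso_sym isoh.
have [k' isok' [kK k'K]] := fusion_iso_sym isok.
have [Fh' sh'] := (fusion_isoP _ _ _).1 isoh.
have [l isol El] : exists2 l, fusion_iso F hP Q l & {in hP, forall y,
  y^-1 * l y \in E}.
  apply: (ext hP Q (k \o h')) => //; last exact: fusion_iso_comp isok.
    have [_ inj_h _] := fusion_inj fusF Fh.
    by rewrite -sh' card_in_imset.
  by case/(fusion_obj fusF): Fh'.
(* On [Q], [a] is [l] after [h] after the inverse of [k]. *)
have [a Aa aE] := fusion_iso_Aut (fusion_iso_comp (fusion_iso_comp isok' isoh) isol).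
have hPhx : h x \in hP by rewrite -sh' imset_f.
have Qkx : k x \in Q by have [_ <-] := (fusion_isoP _ _ _).1 isok;
  apply: imset_f.
(* The displacements telescope along [x], [k x], [a (k x) = l (h x)], and back to [h x]. *)
have := groupM (Ek x Px) (AutE Q a (k x) nQ Aa Qkx).
rewrite aE //= kK // mulgA mulgK => Elhx.
by have := groupM Elhx (groupVr (El _ hPhx)); rewrite invMg invgK mulgA mulgK.
Qed.

(** * Normality of the hyperfocal subgroup *)

Lemma fusion_Aut_conj_sub (P : {group gT}) s : P \subset S -> s \in S ->
  fusion_Aut F P :^ perm (@conjg_inj _ s) \subset fusion_Aut F (P :^ s)%G.
Proof.
move=> sPS Ss; set c := perm _.
have cE y : c y = y ^ s by rewrite permE.
apply/subsetP=> _ /imsetP[a /setIdP[Aut_a Fa] ->].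
have acE y : (a ^ c) y = (a (y ^ s^-1)) ^ s.
  by rewrite -{1}(conjgKV s y) -!cE permJ cE.
have Fac : F (P :^ s)%G (P :^ s)%G (a ^ c).
  rewrite -(@fusion_ext _ _ _ fusF _ _ ((conjg^~ s \o a) \o conjg^~ s^-1)).
    have sPsS : P :^ s \subset S by rewrite conj_subG.
    apply: (@fusion_comp _ _ _ fusF _ P).
      by apply: (fusion_conj fusF); rewrite ?groupV // conjsgK.
    apply: (fusion_comp fusF Fa); exact: (fusion_conj fusF).
  by move=> y _; rewrite acE.
rewrite inE Fac andbT inE; apply/andP; split.
  apply/subsetP=> y; apply: contraR; rewrite mem_conjg => P'y.
  by rewrite /= acE (out_Aut Aut_a) // conjgKV.
by have [Mac _ _] := fusion_inj fusF Fac; apply/morphicP.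
Qed.

Lemma fusion_AutJ (P : {group gT}) s : P \subset S -> s \in S ->
  fusion_Aut F (P :^ s)%G = fusion_Aut F P :^ perm (@conjg_inj _ s).
Proof.
move=> sPS Ss; apply/eqP; rewrite eqEsubset fusion_Aut_conj_sub // andbT.
have sPsS : P :^ s \subset S by rewrite conj_subG.
rewrite -sub_conjgV; have := fusion_Aut_conj_sub sPsS (groupVr Ss).
have -> : conjG_group (conjG_group P s) s^-1 = P by apply: val_inj;
  rewrite /= conjsgK.
suff -> : perm (@conjg_inj _ s^-1) = (perm (@conjg_inj _ s))^-1 by [].
apply: (mulgI (perm (@conjg_inj _ s))).
by rewrite mulgV; apply/permP=> y; rewrite permM !permE conjgK.
Qed.

(** Conjugation by an element [s] of [S] carries the generators attached to [P] to those attached to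
    [P :^ s]. *)
Lemma hyperfocal_normal (p : nat) : hyperfocal p S F <| S.
Proof.
rewrite /normal hyperfocal_sub //; apply/subsetP=> s Ss; rewrite inE /=.
rewrite -genJ gen_subG; apply/subsetP=> _ /imsetP[u /bigcupP[P sPS Hu] ->].
rewrite -mem_conjgV; move: u Hu; apply/subsetP; rewrite gen_subG.
apply/subsetP=> _ /imset2P[x a Px Ra ->]; rewrite mem_conjgV.
pose A := Group (fusion_Aut_group_set fusF sPS).
have Rac : a ^ perm (@conjg_inj _ s) \in p_residual p (fusion_Aut F (P :^ s)%G).
  by rewrite fusion_AutJ //; exact: (p_residualJ (A :=
    A) (perm (@conjg_inj _ s)) Ra).
have Pxs : x ^ s \in P :^ s by rewrite memJ_conjg.
have sPsS : P :^ s \subset S by rewrite conj_subG.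
have acE : (a ^ perm (@conjg_inj _ s)) (x ^ s) = a x ^ s.
  by have := permJ a (perm (@conjg_inj _ s)) x;
    rewrite ![perm (@conjg_inj _ s) _]permE.
by rewrite conjMg conjVg -acE; apply: residual_moves_in_hyperfocal Rac.
Qed.

End Fusion.

(** * Characters of [p]-groups with values in ['F_p] *)

Lemma prime_order_character (p : nat) (gT : finGroupType) (A : {group gT}) :
    prime p -> #|A| = p ->
  exists chi : gT -> 'F_p,
    {in A &, {morph chi : x y / x * y >-> (x + y)%R}}
    /\ {in A, forall x, chi x = 0%R -> x = 1}.
Proof.
move=> p_pr oA; have /cyclicP[g defA] : cyclic A by rewrite prime_cyclic ?oA.
have og : #[g] = p by rewrite orderE -defA.
(* Discrete logarithm to the base [g]; the default 0 is reached only outside [A]. *)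
pose k y : nat := odflt ord0 [pick i : 'I_#[g].+1 | y == g ^+ i].
have kE y : y \in A -> y = g ^+ k y.
  rewrite defA => /cyclePmin[i lti ->]; rewrite /k;
    case: pickP => [j /eqP // | no_i].
  by have /eqP[] := no_i (inord i); rewrite inordK // ltnS ltnW.
have pF := pchar_Fp p_pr.
exists (fun y => (k y)%:R)%R; split=> [x y Ax Ay|x Ax /eqP].
  rewrite -natrD -(Fp_nat_mod p_pr (k x + k y)) -(Fp_nat_mod p_pr (k (x * y))).
  congr (_%:R)%R; apply/eqP.
  by rewrite -og -eq_expg_mod_order expgD -!kE ?groupM.
by rewrite -(dvdn_pcharf pF) -og order_dvdn -kE // => /eqP.
Qed.

(** A normal subgroup of order [p] in a [p]-group is central, so a character of such a section of
    [E] above [H] is automatically invariant under [S]. *)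
Lemma invariant_character (p : nat) (gT : finGroupType) (S E H : {group gT}) :
    prime p -> p.-group S -> H <| S -> E <| S -> ~~ (E \subset H) ->
  exists chi : gT -> 'F_p,
    [/\ {in E &, {morph chi : x y / x * y >-> (x + y)%R}},
        {in E & S, forall x s, chi (x ^ s) = chi x},
        {in H :&: E, forall x, chi x = 0%R}
      & exists2 x, x \in E & chi x != 0%R].
Proof.
move=> p_pr pS /andP[sHS nHS] nsES not_sEH; have [sES nES] := andP nsES.
have pSH : p.-group (S / H) by apply: quotient_pgroup.
have nsEH : E / H <| S / H by apply: quotient_normal.
have ntEH : E / H != 1.
  by apply: contraNneq not_sEH => EH1; rewrite -quotient_sub1 ?EH1 // (subset_trans sES).
have [_ _ [e oEH]] := pgroup_pdiv (pgroupS (normal_sub nsEH) pSH) ntEH.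
have [|M [sME nsM oM]] := @normal_pgroup p _ e _ _ pSH nsEH.
  by rewrite oEH pfactorK.
pose A := (E / H / M)%G.
have nM : E / H \subset 'N(M) := subset_trans (normal_sub nsEH) (normal_norm nsM).
have oA : #|A| = p.
  by rewrite card_quotient // -divgS // oEH oM expnS mulnK // expn_gt0 prime_gt0.
have sAZ : A \subset 'Z(S / H / M).
  apply: prime_meetG; first by rewrite oA.
  rewrite meet_center_nil ?quotient_normal //;
    first exact: pgroup_nil (quotient_pgroup _ pSH).
  by rewrite -cardG_gt1 oA prime_gt1.
have [chi [chiM chi0]] := prime_order_character p_pr oA.
pose q x := coset M (coset H x).
have qM : {in S &, {morph q : x y / x * y}}.
  move=> x y Sx Sy; rewrite /q !morphM ?(subsetP nHS) //.
  by apply: (subsetP (normal_norm nsM)); apply: mem_quotient.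
  by apply: (subsetP (normal_norm nsM)); apply: mem_quotient.
have qA x : x \in E -> q x \in A by move=> Ex; do 2!apply: mem_quotient.
have chi1 : chi 1 = 0%R.
  by apply: (addrI (chi 1)); rewrite addr0 -chiM ?mulg1.
exists (chi \o q); split=> [x y Ex Ey|x s Ex Ss|x /setIP[Hx _]|].
- by rewrite /= qM ?chiM ?qA ?(subsetP sES).
- have Sx := subsetP sES x Ex; congr chi.
  have Exs : x ^ s \in E by rewrite memJ_norm // (subsetP nES).
  have /centerP[_ cx] := subsetP sAZ _ (qA x Ex).
  apply: (mulgI (q s)); rewrite -qM ?(subsetP sES _ Exs) // -conjgC qM // cx //.
  by do 2!apply: mem_quotient.
- by rewrite /= /q (coset_id Hx) (coset_id (group1 M)).
have /trivgPn[_ /morphimP[_ _ /morphimP[x _ Ex ->] ->] nt_x] : A :!=: 1.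
  by rewrite -cardG_gt1 oA prime_gt1.
by exists x => //; apply: contraNneq nt_x => c0;
  apply/eqP/(chi0 _ (qA x Ex) c0).
Qed.

(** The Frattini subgroup of a [p]-group is generated by commutators and [p]-th powers, both killed
    by a homomorphism to ['F_p]. *)
Lemma Phi_character (p : nat) (gT : finGroupType) (S : {group gT})
    (psi : gT -> 'F_p) :
    prime p -> p.-group S ->
    {in S &, {morph psi : x y / x * y >-> (x + y)%R}} ->
  {in 'Phi(S), forall x, psi x = 0%R}.
Proof.
move=> p_pr pS psiM.
have psi1 : psi 1 = 0%R by apply: (addrI (psi 1)); rewrite addr0 -psiM ?mulg1.
pose K := [set x in S | psi x == 0%R].
have gK : group_set K.
  apply/group_setP; split=> [|x y]; first by rewrite inE group1 psi1 eqxx.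
  move=> /setIdP[Sx /eqP x0] /setIdP[Sy /eqP y0].
  by rewrite inE groupM // psiM // x0 y0 addr0 eqxx.
have psiV : {in S, forall x, psi x^-1 = (- psi x)%R}.
  by move=> x Sx; apply: (addrI (psi x));
    rewrite -psiM ?groupV // mulgV psi1 subrr.
suff sPhiK : 'Phi(S) \subset Group gK.
  by move=> x /(subsetP sPhiK) /setIdP[_ /eqP].
rewrite (Phi_joing pS) join_subG (MhoE _ pS) !gen_subG; apply/andP; split.
  apply/subsetP=> _ /imset2P[x y Sx Sy ->]; rewrite inE groupR //.
  by rewrite commgEl conjgE !psiM ?groupM ?groupV // !psiV // [(psi x + _)%R]addrC addKr addNr.
apply/subsetP=> _ /imsetP[x Sx ->]; rewrite inE groupX //= expn1.
have -> n : psi (x ^+ n) = (psi x *+ n)%R.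
  elim: n => [|n IHn]; first by rewrite expg0 psi1.
  by rewrite expgS psiM ?groupX // IHn mulrS.
by rewrite -mulr_natr pchar_Fp_0 // mulr0.
Qed.

(** * Stable classes of the quotient and the conclusion *)

Lemma cohomology_pullback_ext p n (G H : finGroupType) (f g : G -> H) :
  f =1 g -> @cohomology_pullback p n G H f =1 cohomology_pullback g.
Proof.
move=> fg x; congr cohomology_class; congr insubd.
apply/ffunP=> t; rewrite !ffunE; congr (_ _).
by apply: val_inj; apply: eq_map.
Qed.

(** A morphism induced by [h] agrees with the inclusion on [P / E], as [h x] and [x] share a coset
    of [E]; the stability condition compares equal maps. *)
Lemma quotient_fusion_cohomology p n (gT : finGroupType) (S E : {group gT})
    (F : hom_family gT) (z : cohomology p n [subg (S / E)]) :
    is_fusion_system S F -> E <| S ->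
    (forall (P : {group gT}) h x, F P S h -> x \in P -> x^-1 * h x \in E) ->
  z \in fusion_cohomology p n (S / E)%G (fusion_quotient F E).
Proof.
move=> fusF /andP[sES nES] focE; rewrite unfold_in.
apply/forallP=> PT; apply/forallP=> f; apply/implyP.
move=> /(fusion_quotientP fusF)[P [Q [h [_ _ -> _ [Fh fh]]]]].
apply/eqP/cohomology_pullback_ext => u; congr subg.
have /morphimP[x Nx Px ->] := subgP u.
have Ex := focE P h x (fusion_restr fusF Fh (subxx P)) Px.
by rewrite fh // -[h x](mulKVg x) coset_kerr.
Qed.

Theorem corollary1p3 (p : nat) (gT : finGroupType) (S : {group gT})
    (F : hom_family gT) :
  prime p -> p.-group S -> is_fusion_system S F -> is_saturated p S F ->
  let E := elementary_focal p S F in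
  {in fusion_cohomology p 2 (S / E)%G (fusion_quotient F E) &,
    injective (inflation p 2 S E)} ->
  p.-abelem (S / hyperfocal p S F).
Proof.
move=> p_pr pS fusF satF E inj_infl; set H := hyperfocal p S F.
have nsHS : H <| S := hyperfocal_normal fusF p.
have nsES : E <| S by rewrite normalY ?Phi_normal.
have sHE : H \subset E := joing_subr _ _.
have sPhiE : 'Phi(S) \subset E := joing_subl _ _.
have sS'E : S^`(1) \subset E.
  by apply: subset_trans sPhiE; rewrite (Phi_joing pS) joing_subl.
have focE := focal_sub fusF pS satF sS'E sHE.
(* A [p]-group is elementary abelian exactly when its Frattini subgroup is trivial, so the goal
   becomes that ['Phi(S)] lies in [H]. *)
rewrite -trivg_Phi ?quotient_pgroup // -(quotient_Phi pS) ?normal_norm // -subG1.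
rewrite quotient_sub1; last exact: subset_trans (Phi_sub S) (normal_norm nsHS).
apply: contraT => not_sPhiH.
have not_sEH : ~~ (E \subset H) by apply: contra not_sPhiH; apply: subset_trans.
have [chi [chiM chiJ chiH [x0 Ex0 nz_chi]]] :=
  invariant_character p_pr pS nsHS nsES not_sEH.
have nES := normal_norm nsES.
pose f := subg_map S (S / E)%G (coset E).
have fE u : sgval (f u) = coset E (sgval u).
  by rewrite /f /subg_map subgK // mem_quotient // subgP.
have ker_f u : f u = 1 -> sgval u \in E.
  move=> fu; rewrite coset_idr ?(subsetP nES) ?subgP //.
  by rewrite -fE fu.
have [psi psiM psiE] : exists2 psi : [subg S] -> 'F_p,
    {morph psi : x y / x * y >-> (x + y)%R}
    & forall u, f u = 1 -> psi u = chi (sgval u).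
  apply: hom_extension.
  - move=> u v; apply: val_inj.
    by rewrite /= !fE /= morphM // (subsetP nES) ?subgP.
  - move=> v; have /morphimP[x Nx Sx vE] := subgP v; exists (subg S x).
    by apply: val_inj; rewrite /= fE subgK // -vE.
  - by move=> u v /ker_f Eu /ker_f Ev; apply: chiM.
  - by move=> u v /ker_f Eu; apply: chiJ; rewrite ?subgP.
  (* Every class is stable, so injectivity on stable classes is injectivity on all of them. *)
  move=> z t; apply: inj_infl; exact: quotient_fusion_cohomology.
have chiE x : x \in E -> psi (subg S x) = chi x.
  move=> Ex; have Sx := subsetP (normal_sub nsES) x Ex.
  rewrite psiE ?subgK //; apply: val_inj.
  by rewrite /= fE subgK // coset_id.
have psiSM : {in S &, {morph psi \o subg S : x y / x * y >-> (x + y)%R}}.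
  by move=> x y Sx Sy; rewrite /= morphM // psiM.
have psiPhi := Phi_character p_pr pS psiSM.
(* Splitting [x0] over ['Phi(S)] and [H]: [chi] kills the second factor by choice, and the first
   because there it equals [psi]. *)
move: Ex0 nz_chi; rewrite /E elementary_focalE // => /mulsgP[x y Phix Hy ->].
have [Ex Ey] := (subsetP sPhiE x Phix, subsetP sHE y Hy).
rewrite chiM // (chiH y) ?inE ?Hy // -(chiE x Ex).
by rewrite [psi _]psiPhi // addr0 eqxx.
Qed.
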